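(* Let $\mathfrak{L}$ be a split regular Hom-Lie superalgebra with respect to a maximal abelian graded subalgebra $H$, with root system $\Lambda$. Then $$\mathfrak{L}=U+\sum_{[\alpha]\in\Lambda/\sim}\mathfrak{L}_{[\alpha]},$$ where $U$ is a linear complement in $H$ of $\mathrm{span}_{\mathbb{K}}\{[\mathfrak{L}_\alpha,\mathfrak{L}_{-\alpha}]:\alpha\in\Lambda\}$ and every $\mathfrak{L}_{[\alpha]}=H_{[\alpha]}\oplus V_{[\alpha]}$ is an ideal of $\mathfrak{L}$, these ideals satisfying $[\mathfrak{L}_{[\alpha]},\mathfrak{L}_{[\gamma]}]=0$ if $[\alpha]\neq[\gamma]$.
   Context: $\mathbb{K}$ is an arbitrary field; dimensions are arbitrary. A Hom-Lie superalgebra is a $\mathbb{Z}_2$-graded algebra $\mathfrak{L}=\mathfrak{L}_{\bar 0}\oplus\mathfrak{L}_{\bar 1}$ over $\mathbb{K}$ with a bilinear product $[\cdot,\cdot]$ (so $[\mathfrak{L}_{\bar i},\mathfrak{L}_{\bar j}]\subset\mathfrak{L}_{\bar i+\bar j}$) and an even linear map $\phi:\mathfrak{L}\to\mathfrak{L}$ such that, for homogeneous $x\in\mathfrak{L}_{\bar i}$, $y\in\mathfrak{L}_{\bar j}$, $z\in\mathfrak{L}_{\bar k}$, $[x,y]=-(-1)^{\bar i\bar j}[y,x]$ and $(-1)^{\bar i\bar k}[[x,y],\phi(z)]+(-1)^{\bar i\bar j}[[y,z],\phi(x)]+(-1)^{\bar j\bar k}[[z,x],\phi(y)]=0$. It is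 regular if $\phi$ is a superalgebra automorphism. All Hom-Lie superalgebras considered are regular. A graded subalgebra is a graded subspace $A=A_{\bar 0}\oplus A_{\bar 1}$ with $[A,A]\subset A$ and $\phi(A)=A$; it is abelian if $[A,A]=0$. An ideal is a graded subalgebra $I$ with $[I,\mathfrak{L}]\subset I$. Let $H=H_{\bar 0}\oplus H_{\bar 1}$ be a maximal abelian graded subalgebra of $\mathfrak{L}$ (maximal among abelian graded subalgebras). For a linear functional $\alpha:H_{\bar 0}\to\mathbb{K}$ the root space is $\mathfrak{L}_\alpha=\{v\in\mathfrak{L}:[h,v]=\alpha(h)\phi(v)\text{ for all }h\in H_{\bar 0}\}$. The root system is $\Lambda=\{\alpha\in(H_{\bar 0})^*\setminus\{0\}:\mathfrak{L}_\alpha\neq 0\}$. $\mathfrak{L}$ is split (with respect to $H$) if $\mathfrak{L}=H\oplus\bigoplus_{\alpha\in\Lambda}\mathfrak{L}_\alpha$. For $\alpha\in(H_{\bar 0})^*$ and $z\in\mathbb{Z}$, $\alpha\phi^z$ denotes the composition $\alpha\circ(\phi|_{H_{\bar 0}})^z$. Put $-\Lambda=\{-\alpha:\alpha\in\Lambda\}$, $\pm\Lambda=\Lambda\cup(-\Lambda)$, and $\mathbb{N}_0=\{0,1,2,\dots\}$. For $\alpha,\beta\in\Lambda$, $\alpha$ is connected to $\beta$ if there is a finite (ordered) family $\{\alpha_1,\dots,\alpha_k\}\subset\pm\Lambda$, called a connection from $\alpha$ to $\beta$, such that: if $k=1$, $\alpha_1\in\{\alpha\phi^{-n}:n\in\mathbb{N}_0\}\cap\{\pm\beta\phi^{-m}:m\in\mathbb{N}_0\}$;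 if $k\ge 2$, (i) $\alpha_1\in\{\alpha\phi^{-n}:n\in\mathbb{N}_0\}$, (ii) for each $1\le i\le k-2$, $\alpha_1\phi^{-i}+\alpha_2\phi^{-i}+\alpha_3\phi^{-i+1}+\cdots+\alpha_{i+1}\phi^{-1}\in\pm\Lambda$ (that is, $\alpha_1\phi^{-i}+\sum_{j=2}^{i+1}\alpha_j\phi^{-i+j-2}\in\pm\Lambda$), and (iii) $\alpha_1\phi^{-k+1}+\sum_{j=2}^{k}\alpha_j\phi^{-k+j-1}\in\{\pm\beta\phi^{-m}:m\in\mathbb{N}_0\}$. Write $\alpha\sim\beta$ if $\alpha$ is connected to $\beta$; this is an equivalence relation on $\Lambda$, and $[\alpha]\in\Lambda/\sim$ denotes the class of $\alpha$. For $\alpha\in\Lambda$ put $H_{[\alpha]}=\mathrm{span}_{\mathbb{K}}\{[\mathfrak{L}_\beta,\mathfrak{L}_\delta]:\beta,\delta\in[\alpha]\}\cap\mathfrak{L}_0$ (where $\mathfrak{L}_0=H$ is the root space of the zero functional), which equals $\mathrm{span}_{\mathbb{K}}\{[\mathfrak{L}_\beta,\mathfrak{L}_{-\beta}]:\beta\in[\alpha]\}$, put $V_{[\alpha]}=\bigoplus_{\beta\in[\alpha]}\mathfrak{L}_\beta$, and $\mathfrak{L}_{[\alpha]}=H_{[\alpha]}\oplus V_{[\alpha]}$. *)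

(* Defs.v *)
From HB Require Import structures.
From mathcomp Require Import all_boot all_algebra.
From mathcomp Require Import boolp classical_sets functions sesquilinear.

Set Implicit Arguments.
Unset Strict Implicit.
Unset Printing Implicit Defensive.

Import GRing.Theory.

Local Open Scope classical_set_scope.
Local Open Scope ring_scope.

Section Subspaces.
Context {K : fieldType} {V : lmodType K}.
Implicit Types A B C : set V.

Definition subspace A := submod_closed (fun x : V => x \in A).

Definition lspan A : set V := smallest subspace A.

Definition sumset A B : set V := [set a + b | a in A & b in B].

Definition is_dirsum A B C := A `&` B = [set 0] /\ sumset A B = C.

Definition sumspace (I : Type) (P : set I) (F : I -> set V) : set V :=
  lspan (\bigcup_(i in P) F i).

Definition independent (I : Type) (P : set I) (F : I -> set V) :=
  forall i, P i -> F i `&` sumspace (P `\ i) F = [set 0].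

(* U is a linear complement of A in B *)
Definition linear_complement B A U := subspace U /\ is_dirsum U A B.

End Subspaces.

(* Degrees in Z_2 are encoded as booleans (false is the even degree), so that
   the sum of degrees is (+) and their product is &&. *)
Record homLieSuperalgebra (K : fieldType) := HomLieSuperalgebra {
  hls_sort :> lmodType K;
  hls_part : bool -> set hls_sort;
  hls_bracket : {bilinear hls_sort -> hls_sort -> hls_sort};
  hls_twist : {linear hls_sort -> hls_sort};
  hls_part_subspace : forall i, subspace (hls_part i);
  hls_part_dirsum : is_dirsum (hls_part false) (hls_part true) setT;
  hls_bracket_part : forall i j x y, hls_part i x -> hls_part j y ->
    hls_part (i (+) j) (hls_bracket x y);
  hls_twist_even : forall i x, hls_part i x -> hls_part i (hls_twist x);
  hls_skew : forall i j x y, hls_part i x -> hls_part j y ->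
    hls_bracket x y = - ((-1) ^+ (i && j) *: hls_bracket y x);
  hls_jacobi : forall i j k x y z,
    hls_part i x -> hls_part j y -> hls_part k z ->
    (-1) ^+ (i && k) *: hls_bracket (hls_bracket x y) (hls_twist z)
    + (-1) ^+ (i && j) *: hls_bracket (hls_bracket y z) (hls_twist x)
    + (-1) ^+ (j && k) *: hls_bracket (hls_bracket z x) (hls_twist y) = 0
}.

Arguments hls_part {K L} i : rename.
Arguments hls_bracket {K L} : rename.
Arguments hls_twist {K L} : rename.

Section HomLie.
Context {K : fieldType} (L : homLieSuperalgebra K).
Implicit Types A B I : set L.

Definition is_regular :=
  bijective (@hls_twist K L) /\
  {morph (@hls_twist K L) : x y / hls_bracket x y}.

Definition prodset A B : set L := [set hls_bracket x y | x in A & y in B].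

Definition graded_subspace A :=
  subspace A /\ is_dirsum (A `&` hls_part false) (A `&` hls_part true) A.

Definition graded_subalgebra A :=
  [/\ graded_subspace A, prodset A A `<=` A & hls_twist @` A = A].

Definition abelian A := prodset A A `<=` [set 0].

Definition is_ideal I := graded_subalgebra I /\ prodset I setT `<=` I.

Definition maximal_abelian A :=
  [/\ graded_subalgebra A, abelian A &
      forall B, graded_subalgebra B -> abelian B -> A `<=` B -> B = A].

Record gradedSubalgebra := GradedSubalgebra {
  gs_set :> set L;
  gs_graded : graded_subalgebra gs_set
}.

End HomLie.

Section Roots.
Context {K : fieldType} {L : homLieSuperalgebra K} (H : gradedSubalgebra L).

Definition even_pred : {pred L} :=
  fun x => x \in gs_set H `&` hls_part false.

Lemma even_predP x : reflect (gs_set H x /\ hls_part false x) (x \in even_pred).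
Proof. by rewrite unfold_in; apply: (iffP idP) => [/set_mem|/mem_set]. Qed.

Lemma even_pred_submod : submod_closed even_pred.
Proof.
have [[[H0 HZ] _] _ _] := gs_graded H.
have [P0 PZ] := hls_part_subspace L false.
split; first by apply/even_predP; split; exact: set_mem.
move=> a u v /even_predP[Hu Pu] /even_predP[Hv Pv]; apply/even_predP.
by split; apply: set_mem; [apply: HZ | apply: PZ]; exact: mem_set.
Qed.

HB.instance Definition _ :=
  GRing.isSubmodClosed.Build K L even_pred
    (GRing.submod_closed_semi even_pred_submod).

(* The even part H_0 of H, as a K-module in its own right. *)
Definition even_part := {x : L | x \in even_pred}.

HB.instance Definition _ := SubType.on even_part.
HB.instance Definition _ := Choice.on even_part.
HB.instance Definition _ := [SubChoice_isSubLmodule of even_part by <:].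

Lemma twist_even_pred (h : even_part) : hls_twist (val h) \in even_pred.
Proof.
case: h => h /= /even_predP[Hh Ph]; apply/even_predP; split.
  by have [_ _ <-] := gs_graded H; exists h.
exact: hls_twist_even.
Qed.

Definition even_twist (h : even_part) : even_part :=
  exist _ (hls_twist (val h)) (twist_even_pred h).

Lemma even_twist_surj (h : even_part) : exists h', even_twist h' = h.
Proof.
case: h => h hE; have /even_predP[Hh Ph] := hE.
have [[_ [_ HD]] _ HT] := gs_graded H.
have [h' Hh' Eh] : (hls_twist @` gs_set H) h by rewrite HT.
have [a [Ha Pa] [b [Hb Pb] Eab]] :
    sumset (gs_set H `&` hls_part false) (gs_set H `&` hls_part true) h'.
  by rewrite HD.
have aE : a \in even_pred by apply/even_predP.
exists (exist _ a aE); apply: val_inj => /=.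
have [_ PZ] := hls_part_subspace L false.
have [PI _] := hls_part_dirsum L.
suff Tb0 : hls_twist b = 0 by rewrite -Eh -Eab linearD Tb0 addr0.
have : (hls_part false `&` hls_part true) (hls_twist b).
  split; last exact: hls_twist_even.
  have -> : hls_twist b = (-1) *: hls_twist a + h.
    by rewrite -Eh -Eab linearD scaleN1r addrA addNr add0r.
  by apply: set_mem; apply: PZ; apply: mem_set => //; exact: hls_twist_even.
by rewrite PI.
Qed.

Definition even_twistV (h : even_part) : even_part :=
  projT1 (cid (even_twist_surj h)).

(* The power (phi|_{H_0})^z; even_twistV is a two-sided inverse of even_twist
   as soon as the twist is injective, in particular when L is regular. *)
Definition even_twist_pow (z : int) : even_part -> even_part :=
  match z with
  | Posz n => iter n even_twist
  | Negz n => iter n.+1 even_twistV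
  end.

Definition twisted (alpha : even_part -> K) (z : int) : even_part -> K :=
  alpha \o even_twist_pow z.

Definition root_space (alpha : even_part -> K) : set L :=
  [set v | forall h : even_part,
     hls_bracket (val h) v = alpha h *: hls_twist v].

Definition roots : set (even_part -> K) :=
  [set alpha | [/\ scalar alpha, alpha != 0 & root_space alpha != [set 0]]].

Definition is_split :=
  is_dirsum (gs_set H) (sumspace roots root_space) setT /\
  independent roots root_space.

Definition pm_roots : set (even_part -> K) :=
  roots `|` [set - alpha | alpha in roots].

Definition neg_twists (alpha : even_part -> K) : set (even_part -> K) :=
  [set twisted alpha (- n%:Z) | n in [set: nat]].

Definition pm_neg_twists (beta : even_part -> K) : set (even_part -> K) :=
  neg_twists beta `|` [set - gamma | gamma in neg_twists beta].

Definition chain_sum (a : nat -> even_part -> K) (i : nat) : even_part -> K :=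
  twisted (a 1%N) (- i%:Z)
  + \sum_(2 <= j < i.+2) twisted (a j) (- i%:Z + j%:Z - 2).

(* Only the values a 1, ..., a k are relevant. For i = k - 1 the exponent
   - i + j - 2 in chain_sum is - k + j - 1. *)
Definition is_connection (alpha beta : even_part -> K) (k : nat)
    (a : nat -> even_part -> K) :=
  [/\ (0 < k)%N,
      forall j, (1 <= j <= k)%N -> pm_roots (a j),
      k = 1%N -> (neg_twists alpha `&` pm_neg_twists beta) (a 1%N)
    & (2 <= k)%N ->
      [/\ neg_twists alpha (a 1%N),
          forall i, (1 <= i <= k - 2)%N -> pm_roots (chain_sum a i)
        & pm_neg_twists beta (chain_sum a k.-1)]].

Definition connected (alpha beta : even_part -> K) :=
  exists k a, is_connection alpha beta k a.

Definition root_class (alpha : even_part -> K) : set (even_part -> K) :=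
  [set beta | roots beta /\ connected alpha beta].

Definition root_classes : set (set (even_part -> K)) :=
  [set root_class alpha | alpha in roots].

Definition class_H (C : set (even_part -> K)) : set L :=
  lspan (\bigcup_(beta in C) \bigcup_(delta in C)
          prodset (root_space beta) (root_space delta))
  `&` root_space 0.

Definition class_V (C : set (even_part -> K)) : set L := sumspace C root_space.

Definition class_L (C : set (even_part -> K)) : set L :=
  sumset (class_H C) (class_V C).

Definition opposite_products : set L :=
  lspan (\bigcup_(alpha in roots)
          prodset (root_space alpha) (root_space (- alpha))).

End Roots.

Arguments root_space {K L} H alpha _.
Arguments roots {K L} H _.
Arguments root_classes {K L} H _.
Arguments class_H {K L} H C _.
Arguments class_V {K L} H C _.
Arguments class_L {K L} H C _.
Arguments opposite_products {K L} H _.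

(* Main.v *)
(* Composition with phi^-1 is an additive injection T of the functionals on H_0,
   and [L_a, L_b] lies in L_(T (a + b)). A connection is thus a walk on the
   roots up to sign, with steps s |-> T (s + a_i); such a walk can be concatenated
   and reversed, which makes connection an equivalence relation. By the above,
   a nonzero bracket of two root vectors forces their roots to be connected, and
   by the Hom-Jacobi identity the same holds for the action of [L_a, L_-a] on
   L_d. Since L is spanned by H = L_0 and the root spaces, the theorem follows
   by checking brackets of generators. *)

From HB Require Import structures.
Require Import Defs.
From mathcomp Require Import all_boot all_algebra zify.
From mathcomp Require Import boolp classical_sets functions sesquilinear.

Local Open Scope classical_set_scope.
Local Open Scope ring_scope.

Set Implicit Arguments.
Unset Strict Implicit.
Unset Printing Implicit Defensive.

Import GRing.Theory.

(** * Subspaces, spans, independent families and linear complements *)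

Section SubspaceTheory.
Context {K : fieldType} {V : lmodType K}.
Implicit Types A B U W : set V.

Lemma subspaceP A :
  subspace A <-> A 0 /\ (forall a u v, A u -> A v -> A (a *: u + v)).
Proof.
split=> -[A0 AZ]; split; first exact: set_mem.
- by move=> a u v Au Av; apply: set_mem; apply: AZ; exact: mem_set.
- exact: mem_set.
- by move=> a u v /set_mem Au /set_mem Av; apply: mem_set; exact: AZ.
Qed.

Lemma subspace0 A : subspace A -> A 0.
Proof. by case/subspaceP. Qed.

Lemma subspaceD A u v : subspace A -> A u -> A v -> A (u + v).
Proof. by case/subspaceP=> _ /(_ 1 u v); rewrite scale1r. Qed.

Lemma subspaceZ A a u : subspace A -> A u -> A (a *: u).
Proof.
by case/subspaceP=> A0 /(_ a u 0); rewrite addr0 => h /h; apply.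
Qed.

Lemma subspaceN A u : subspace A -> A u -> A (- u).
Proof. by move=> sA Au; rewrite -scaleN1r; exact: subspaceZ. Qed.

Lemma subspaceB A u v : subspace A -> A u -> A v -> A (u - v).
Proof. by move=> sA Au Av; apply: subspaceD => //; exact: subspaceN. Qed.

Lemma subspace_set0 : subspace [set 0 : V].
Proof.
by apply/subspaceP; split=> // a u v /= -> ->; rewrite scaler0 addr0.
Qed.

Lemma subspace_setI A B : subspace A -> subspace B -> subspace (A `&` B).
Proof.
move=> /subspaceP[A0 AZ] /subspaceP[B0 BZ]; apply/subspaceP; split=> //.
by move=> a u v [Au Bu] [Av Bv]; split; [exact: AZ | exact: BZ].
Qed.

Lemma subspace_bigcap (I : Type) (P : set I) (F : I -> set V) :
  (forall i, P i -> subspace (F i)) -> subspace (\bigcap_(i in P) F i).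
Proof.
move=> sF; apply/subspaceP; split=> [i /sF|a u v Fu Fv i Pi].
  exact: subspace0.
have /subspaceP[_ FZ] := sF i Pi; apply: FZ; [exact: Fu | exact: Fv].
Qed.

Lemma lspan_subspace A : subspace (lspan A).
Proof. by apply: subspace_bigcap => B []. Qed.

Lemma sub_lspan A : A `<=` lspan A.
Proof. exact: sub_gen_smallest. Qed.

Lemma lspan_sub A W : subspace W -> A `<=` W -> lspan A `<=` W.
Proof. exact: smallest_sub. Qed.

Lemma lspanS A B : A `<=` B -> lspan A `<=` lspan B.
Proof.
move=> AB; apply: lspan_sub; first exact: lspan_subspace.
by move=> x /AB; exact: sub_lspan.
Qed.

Lemma sumset_subspace A B :
  subspace A -> subspace B -> subspace (sumset A B).
Proof.
move=> sA sB; apply/subspaceP; split.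
  exists 0; first exact: subspace0.
  by exists 0; rewrite ?addr0 //; exact: subspace0.
move=> c _ _ [a Aa [b Bb <-]] [a' Aa' [b' Bb' <-]].
exists (c *: a + a'); first by apply: subspaceD => //; exact: subspaceZ.
exists (c *: b + b'); first by apply: subspaceD => //; exact: subspaceZ.
by rewrite scalerDr addrACA.
Qed.

Lemma sumset_subl A B : subspace B -> A `<=` sumset A B.
Proof.
move=> sB a Aa; exists a => //.
by exists 0; rewrite ?addr0 //; exact: subspace0.
Qed.

Lemma sumset_subr A B : subspace A -> B `<=` sumset A B.
Proof.
by move=> sA b Bb; exists 0; [exact: subspace0 | exists b; rewrite ?add0r].
Qed.

Lemma sumset_sub A B W :
  subspace W -> A `<=` W -> B `<=` W -> sumset A B `<=` W.
Proof.
move=> sW AW BW _ [a Aa [b Bb <-]].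
by apply: subspaceD => //; [exact: AW | exact: BW].
Qed.

Lemma sumspace_subspace (I : Type) (P : set I) (F : I -> set V) :
  subspace (sumspace P F).
Proof. exact: lspan_subspace. Qed.

Lemma sub_sumspace (I : Type) (P : set I) (F : I -> set V) i :
  P i -> F i `<=` sumspace P F.
Proof. by move=> Pi x Fx; apply: sub_lspan; exists i. Qed.

Lemma sumspace_sub (I : Type) (P : set I) (F : I -> set V) W :
  subspace W -> (forall i, P i -> F i `<=` W) -> sumspace P F `<=` W.
Proof. by move=> sW FW; apply: lspan_sub => // x [i Pi]; exact: FW. Qed.

Lemma sumspaceS (I : Type) (P Q : set I) (F : I -> set V) :
  P `<=` Q -> sumspace P F `<=` sumspace Q F.
Proof.
move=> PQ; apply: sumspace_sub; first exact: sumspace_subspace.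
by move=> i /PQ; exact: sub_sumspace.
Qed.

Lemma independentS (I : Type) (P Q : set I) (F : I -> set V) :
  (forall i, subspace (F i)) -> P `<=` Q -> independent Q F -> independent P F.
Proof.
move=> sF PQ indF i Pi; apply/seteqP; split=> [x [Fx Sx]|_ ->].
  rewrite -(indF i (PQ i Pi)); split=> //.
  by apply: sumspaceS Sx => j [Pj ij]; split=> //; exact: PQ.
split; [exact: subspace0 | exact: (subspace0 (sumspace_subspace _ _))].
Qed.

(** Finite supports supply the induction in [independent_eq0]; a linear combination of two vectors
    is supported on the concatenation of their lists. *)
Lemma sumspace_finite (I : eqType) (P : set I) (F : I -> set V) x :
  sumspace P F x ->
  exists s : seq I, sumspace (P `&` [set i | i \in s]) F x.
Proof.
move: x; apply: lspan_sub => [|x [i Pi Fx]].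
  apply/subspaceP; split=> [|a u v [s su] [t tv]].
    by exists [::]; exact: (subspace0 (sumspace_subspace _ _)).
  exists (s ++ t); apply: (subspaceD (sumspace_subspace _ _)).
    apply: (subspaceZ _ (sumspace_subspace _ _)).
    by apply: sumspaceS su => i [Pi /= si]; split=> //=; rewrite mem_cat si.
  by apply: sumspaceS tv => i [Pi /= ti]; split=> //=; rewrite mem_cat ti orbT.
exists [:: i]; apply: (@sub_sumspace _ _ _ i) => //.
by split=> //=; rewrite mem_seq1.
Qed.

(** The support of [x] shrinks one index at a time: the component of [x] at [i] is the difference of
    two vectors of the sum over the indices other than [i], so independence makes it vanish. *)
Lemma independent_eq0 (I : eqType) (P : set I) (F : I -> set V) x :
  (forall i, subspace (F i)) -> independent P F -> sumspace P F x ->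
  (forall i, P i -> sumspace (P `\ i) F x) -> x = 0.
Proof.
move=> sF indF /sumspace_finite[s]; elim: s x => [|i s IHs] x Sx xF.
  move: x Sx {xF}; apply: sumspace_sub; first exact: subspace_set0.
  by move=> i [].
have [Pi|nPi] := pselect (P i); last first.
  apply: IHs => //; apply: sumspaceS Sx => j [Pj /=].
  by rewrite inE => /orP[/eqP ji|//]; rewrite ji in Pj.
(* A repeated index adds nothing. When [i] is fresh, the part supported on [s] avoids [i]. *)
have [si|/negP nsi] := pselect (i \in s).
  apply: IHs => //; apply: sumspaceS Sx => j [Pj /=].
  by rewrite inE => /orP[/eqP ->|].
have [y Fy [z Sz xE]] :
    sumset (F i) (sumspace (P `&` [set j | j \in s]) F) x.
  move: x Sx {xF}; apply: sumspace_sub.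
    by apply: sumset_subspace => //; exact: sumspace_subspace.
  move=> j [Pj /=]; rewrite inE => /orP[/eqP ->|sj] x Fx.
    by apply: sumset_subl => //; exact: sumspace_subspace.
  by apply: sumset_subr => //; exact: sub_sumspace Fx.
have y0 : y = 0.
  suff : (F i `&` sumspace (P `\ i) F) y by rewrite indF.
  split=> //; have -> : y = x - z by rewrite -xE addrK.
  apply: (subspaceB (sumspace_subspace _ _)); first exact: xF.
  apply: sumspaceS Sz => j [Pj /= sj]; split=> //= ji.
  by rewrite ji (negPf nsi) in sj.
have zx : z = x by rewrite -xE y0 add0r.
by apply: IHs => //; rewrite -zx.
Qed.

(* Zorn's lemma is applied to the subsets of B whose span meets A trivially:
   unlike the subspaces meeting A trivially, they include the union of the
   empty chain. *)
Lemma linear_complement_exists A B :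
  subspace A -> subspace B -> A `<=` B -> exists U, linear_complement B A U.
Proof.
move=> sA sB AB.
pose P X := X `<=` B /\ (forall x, lspan X x -> A x -> x = 0).
have [|X [[XB XA] Xmax]] := @Zorn_bigcup V P.
  move=> F FP Ftot; split=> [x [X /FP[XB _]]|x Fx Ax]; first exact: XB.
  suff [->//|[X FX Xx]] : x = 0 \/ (exists2 X, F X & lspan X x).
    by have [_] := FP X FX; exact.
  move: x Fx {Ax}; apply: lspan_sub => [|x [X FX Xx]]; last first.
    by right; exists X => //; exact: sub_lspan.
  apply/subspaceP; split=> [|a u v]; first by left.
  have sp Y := lspan_subspace Y.
  case=> [->|[X FX Xu]]; first by rewrite scaler0 add0r.
  case=> [->|[Y FY Yv]].
    by right; exists X => //; rewrite addr0; exact: (subspaceZ _ (sp X)).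
  right; case: (Ftot X Y FX FY) => [XY|YX].
    exists Y => //; apply: (subspaceD (sp Y)) => //.
    by apply: (subspaceZ _ (sp Y)); exact: lspanS Xu.
  exists X => //; apply: (subspaceD (sp X)); first exact: (subspaceZ _ (sp X)).
  exact: lspanS Yv.
have sX : subspace (lspan X) := lspan_subspace X.
have XsB : lspan X `<=` B by exact: lspan_sub.
exists (lspan X); split=> //; split.
  apply/seteqP; split=> [x [Xx Ax]|_ ->]; first exact: XA.
  by split; exact: subspace0.
apply/seteqP; split; first exact: sumset_sub.
move=> b Bb; apply: contrapT => nb.
pose S := sumset (lspan X) A.
have sS : subspace S by exact: sumset_subspace.
(* With [b] outside the sum, [X] and [b] together still span a subspace meeting [A] trivially,
   against maximality: a vector of [A] with a nonzero coefficient at [b] would put [b] into the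
   sum. *)
apply: (Xmax (X `|` [set b])).
  split=> [x Xx|Xb]; first by left.
  by apply: nb; apply: (sumset_subl sA); apply: sub_lspan; apply: Xb; right.
split=> [x [/XB//|->//]|x xX Ax].
have [c [u [Xu xE]]] : exists c u, lspan X u /\ x = c *: b + u.
  move: x xX {Ax}; apply: lspan_sub => [|x [Xx|->]].
  - apply/subspaceP; split=> [|a _ _ [c [u [Xu ->]]] [d [v [Xv ->]]]].
      by exists 0, 0; rewrite scale0r addr0; split=> //; exact: subspace0.
    exists (a * c + d), (a *: u + v); split.
      by apply: (subspaceD sX) => //; exact: (subspaceZ _ sX).
    by rewrite scalerDr scalerDl scalerA addrACA.
  - by exists 0, x; rewrite scale0r add0r; split=> //; exact: sub_lspan.
  - by exists 1, 0; rewrite scale1r addr0; split=> //; exact: subspace0.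
have [c0|c0] := eqVneq c 0.
  by apply: XA => //; rewrite xE c0 scale0r add0r.
case: nb; have -> : b = c^-1 *: (x - u).
  by rewrite xE addrK scalerA mulVf // scale1r.
apply: (subspaceZ _ sS); apply: (subspaceB sS); first exact: sumset_subr.
exact: sumset_subl.
Qed.

End SubspaceTheory.

(** * Images and preimages of subspaces under linear maps *)

Section LinearMaps.
Context {K : fieldType} {V V' : lmodType K}.
Implicit Types A : set V.

Lemma subspace_preimage (f : {linear V' -> V}) A :
  subspace A -> subspace (f @^-1` A).
Proof.
move=> sA; apply/subspaceP; split=> [|c u v fu fv] /=.
  by rewrite linear0; exact: subspace0.
by rewrite linearP; apply: (subspaceD sA) => //; exact: (subspaceZ _ sA).
Qed.

Lemma subspace_image (f : {linear V' -> V}) (B : set V') :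
  subspace B -> subspace (f @` B).
Proof.
move=> sB; apply/subspaceP; split=> [|c _ _ [u Bu <-] [v Bv <-]].
  by exists 0; rewrite ?linear0 //; exact: subspace0.
exists (c *: u + v); rewrite ?linearP //.
by apply: (subspaceD sB) => //; exact: (subspaceZ _ sB).
Qed.

End LinearMaps.

(** * Walks in an abelian group, up to sign and twist *)

Section Connectivity.
Context {G : zmodType} (P : set G) (T : {additive G -> G}).
Hypotheses (PN : forall x, P x -> P (- x)) (PT : forall x, P x -> P (T x)).
Implicit Types (x y z t : G) (b : bool) (m n : nat).

(* The steps follow the brackets: [L_y, L_a] lies in L_(T (y + a)). *)
Inductive reach x : G -> Prop :=
| reach_iter n : reach x (iter n T x)
| reach_step y a : reach x y -> P a -> P (T (y + a)) -> reach x (T (y + a)).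

Definition opp_if b x := if b then - x else x.

Lemma opp_ifD b x y : opp_if b (x + y) = opp_if b x + opp_if b y.
Proof. by case: b => //=; rewrite opprD. Qed.

Lemma opp_if_opp_if b c x : opp_if b (opp_if c x) = opp_if (b (+) c) x.
Proof. by case: b; case: c => //=; rewrite opprK. Qed.

Lemma opp_if_closed b x : P x -> P (opp_if b x).
Proof. by case: b => //=; exact: PN. Qed.

Lemma iter_additiveD m x y : iter m T (x + y) = iter m T x + iter m T y.
Proof. by elim: m => //= m ->; rewrite raddfD. Qed.

Lemma iter_opp_if m b x : iter m T (opp_if b x) = opp_if b (iter m T x).
Proof. by case: b => //=; elim: m => //= m ->; rewrite raddfN. Qed.

Lemma iter_closed m x : P x -> P (iter m T x).
Proof. by move=> Px; elim: m => //= m; exact: PT. Qed.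

Lemma reach_closed x y : P x -> reach x y -> P y.
Proof. by move=> Px [n|//]; exact: iter_closed. Qed.

(** The sign [b] and the exponent [m] stand for the set of all [± beta phi^-m], in which a
    connection to [beta] has to end. *)
Definition linked x y := exists b m, reach x (opp_if b (iter m T y)).

(** By additivity [T] turns a step by [a] into a step by [T a], so a walk can be twisted as a
    whole. *)
Lemma reach_twist x y : reach x y -> reach x (T y).
Proof.
elim=> [n|y' a _ IH Pa Py]; first exact: (reach_iter x n.+1).
rewrite [T (y' + a)]raddfD; apply: reach_step => //; first exact: PT.
by rewrite -raddfD; exact: PT.
Qed.

(** Concatenation: the walk from [y] is replayed from the signed twist of [y] at which the first
    walk ends. Each step [a] becomes [± T^m a], which stays in [P]. *)
Lemma linked_reach x y t : linked x y -> reach y t -> linked x t.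
Proof.
case=> b [m xy] yt; exists b, m; elim: yt => [n|t' a _ IH Pa Pt'].
  rewrite -iterD addnC iterD -iter_opp_if.
  rewrite iter_opp_if; elim: n => [|n IHn] //.
  rewrite -!iter_opp_if in IHn *; rewrite iterS; exact: reach_twist.
have E : opp_if b (iter m T (T (t' + a))) =
         T (opp_if b (iter m T t') + opp_if b (iter m T a)).
  by rewrite -opp_ifD -iter_additiveD -iterSr iterS -(iter_opp_if 1).
rewrite E; apply: reach_step => //; first exact/opp_if_closed/iter_closed.
by rewrite -E; exact/opp_if_closed/iter_closed.
Qed.

Lemma linked_refl x : linked x x.
Proof. by exists false, 0%N; exact: (reach_iter x 0). Qed.

Lemma linkedN x : linked x (- x).
Proof. by exists true, 0%N; rewrite /= opprK; exact: (reach_iter x 0). Qed.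

Lemma linked_twist x : linked x (T x).
Proof. by exists false, 0%N; exact: (reach_iter x 1). Qed.

Lemma twist_linked x : linked (T x) x.
Proof. by exists false, 1%N; exact: (reach_iter (T x) 0). Qed.

Lemma linked_step x a : P a -> P (T (x + a)) -> linked x (T (x + a)).
Proof.
by exists false, 0%N; apply: reach_step => //; exact: (reach_iter x 0).
Qed.

Lemma linked_trans x y z : linked x y -> linked y z -> linked x z.
Proof.
move=> xy [b [m yz]]; have [c [n]] := linked_reach xy yz.
by rewrite iter_opp_if opp_if_opp_if -iterD; exists (c (+) b), (n + m)%N.
Qed.

Lemma linked_opp_if x b m : linked x (opp_if b (iter m T x)).
Proof.
apply: (@linked_trans _ (iter m T x)).
  by exists false, 0%N; exact: reach_iter.
by case: b; [exact: linkedN | exact: linked_refl].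
Qed.

Lemma iter_linked x n : linked (iter n T x) x.
Proof. by exists false, n; exact: (reach_iter _ 0). Qed.

(* A step z = T (y + a) is undone by the step T (z - T a) = T (T y). *)
Lemma reach_linked x y : P x -> reach x y -> linked y x.
Proof.
move=> Px; elim=> [n|t a xt IH Pa Pz]; first exact: iter_linked.
apply: linked_trans IH; apply: (@linked_trans _ (T (T t))); last first.
  apply: (@linked_trans _ (T t)); exact: twist_linked.
have E : T (T t) = T (T (t + a) + - T a) by rewrite [T (t + a)]raddfD addrK.
rewrite E; apply: linked_step; first exact/PN/PT.
by rewrite -E; do 2!apply: PT; exact: reach_closed xt.
Qed.

(** The walk from [x] ends at a signed twist of [y], to which [y] is linked; the reversed walk leads
    from there back to [x]. *)
Lemma linked_sym x y : P x -> linked x y -> linked y x.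
Proof.
move=> Px [b [m xy]]; apply: linked_trans (reach_linked Px xy).
exact: linked_opp_if.
Qed.

(** Horner form of the partial sums [chain_sum]. The entries are numbered from 1, and [chain a i]
    reads [a 1] up to [a (i + 1)]. *)
Fixpoint chain (a : nat -> G) i :=
  if i is j.+1 then T (chain a j + a j.+2) else a 1%N.

Lemma eq_chain (a a' : nat -> G) i :
  (forall j, (1 <= j <= i.+1)%N -> a j = a' j) -> chain a i = chain a' i.
Proof.
elim: i => [|i IH] aa' /=; first exact: aa'.
rewrite IH ?aa' ?leqnn // => j /andP[j1 ji].
by apply: aa'; rewrite j1 leqW.
Qed.

(** Passage between inductive walks and the families of a connection. Here [k] counts the steps, so
    the family has [k + 1] members, the first being the initial twist of [x]. *)
Lemma reachP x y : P x ->
  reach x y <-> exists k a,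
    [/\ exists n, a 1%N = iter n T x,
        forall j, (1 <= j <= k.+1)%N -> P (a j),
        forall i, (1 <= i <= k)%N -> P (chain a i)
      & chain a k = y].
Proof.
move=> Px; split=> [|[k [a [[n a1] Pa Pc <-]]]].
  elim=> [n|t c _ [k [a [[n a1] Pa Pc <-]]] Pc' PT'].
    exists 0%N, (fun=> iter n T x); split=> [|j _|[]|] //; first by exists n.
    exact: iter_closed.
  (* The new step [c] becomes the entry [k + 2]; the entries after it are never read. *)
  pose a' j := if (j <= k.+1)%N then a j else c.
  have ca i : (i <= k)%N -> chain a' i = chain a i.
    move=> ik; apply: eq_chain => j /andP[_ ji].
    by rewrite /a' (leq_trans ji).
  have cS : chain a' k.+1 = T (chain a k + c).
    by rewrite /= ca // /a' ltnn.
  exists k.+1, a'; split=> //; first by exists n.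
    move=> j /andP[j1 jk]; rewrite /a'; case: ifPn => // jk'.
    by apply: Pa; rewrite j1.
  move=> i /andP[i1]; rewrite leq_eqVlt ltnS => /orP[/eqP ->|ik].
    by rewrite cS.
  by rewrite ca //; apply: Pc; rewrite i1.
elim: k Pa Pc => [|k IH] Pa Pc /=; first by rewrite a1; exact: reach_iter.
apply: reach_step.
- by apply: IH => [j|i] /andP[h1 h2]; [apply: Pa|apply: Pc]; rewrite h1 leqW.
- by apply: Pa; rewrite leqnn.
- by apply: (Pc k.+1); rewrite leqnn.
Qed.

End Connectivity.

(** * Homogeneous vectors and graded subspaces *)

Section Grading.
Context {K : fieldType} {L : homLieSuperalgebra K}.
Implicit Types (A B W : set L) (x y z : L).

Local Notation br := hls_bracket.
Local Notation phi := hls_twist.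
Local Notation part := hls_part.

Definition homogeneous : set L := part false `|` part true.

Lemma homogeneousP x : homogeneous x <-> exists i, part i x.
Proof.
by split=> [[|]|[[]]] xi; by [exists false | exists true | right | left].
Qed.

Lemma part_eq0 x : part false x -> part true x -> x = 0.
Proof.
move=> x0 x1; have [P01 _] := hls_part_dirsum L.
by have : (part false `&` part true) x by []; rewrite P01.
Qed.

Lemma prodset_lspan A B W :
  subspace W -> prodset A B `<=` W -> prodset (lspan A) (lspan B) `<=` W.
Proof.
move=> sW ABW _ [x Ax [y By <-]].
suff: lspan A `<=` [set x | forall y, lspan B y -> W (br x y)] by apply.
apply: lspan_sub => {x Ax y By} [|x Ax].
  apply/subspaceP; split=> [y _|a u v Wu Wv y By].
    by rewrite linear0l; exact: subspace0.
  rewrite linearPl; apply: (subspaceD sW); last exact: Wv.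
  by apply: (subspaceZ _ sW); exact: Wu.
apply: lspan_sub => [|y By]; last by apply: ABW; exists x => //; exists y.
apply/subspaceP; split=> [|a u v Wu Wv].
  by rewrite linear0r; exact: subspace0.
rewrite linearPr; apply: (subspaceD sW); last exact: Wv.
by apply: (subspaceZ _ sW); exact: Wu.
Qed.

Lemma graded_homogeneous A : graded_subspace A -> A = lspan (A `&` homogeneous).
Proof.
move=> [sA [_ AE]]; apply/seteqP; split=> [x|]; last first.
  by apply: lspan_sub => // x [].
rewrite -{1}AE => -[x0 [A0 p0] [x1 [A1 p1] <-]].
apply: (subspaceD (lspan_subspace _)); apply: sub_lspan; split=> //.
  by left.
by right.
Qed.

(** It is enough to split the generators: the even and the odd part of the span add up to a
    subspace, which contains the span once it contains [A]. *)
Lemma lspan_homogeneous_graded A :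
  A `<=` lspan (lspan A `&` homogeneous) -> graded_subspace (lspan A).
Proof.
move=> AE; have sA := lspan_subspace A; split=> //; split.
  apply/seteqP; split=> [x [[_ p0] [_ p1]]|_ ->]; first exact: part_eq0.
  by split; split; apply: subspace0 => //; exact: hls_part_subspace.
have sI i : subspace (lspan A `&` part i).
  by apply: subspace_setI => //; exact: hls_part_subspace.
apply/seteqP; split; first by apply: sumset_sub => // x [].
apply: lspan_sub; first exact: sumset_subspace.
move=> x /AE; move: x; apply: lspan_sub; first exact: sumset_subspace.
move=> x [Ax [p0|p1]].
  by apply: sumset_subl.
by apply: sumset_subr.
Qed.

(** Skew-symmetry and the Hom-Jacobi identity are available for homogeneous vectors only; this
    carries their consequences over to arbitrary vectors of graded subspaces. *)
Lemma graded_prodset A B W :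
  graded_subspace A -> graded_subspace B -> subspace W ->
  (forall i j x y, A x -> part i x -> B y -> part j y -> W (br x y)) ->
  prodset A B `<=` W.
Proof.
move=> gA gB sW ABW.
rewrite (graded_homogeneous gA) (graded_homogeneous gB).
apply: prodset_lspan => //.
move=> _ [x [Ax /homogeneousP[i pi]] [y [By /homogeneousP[j pj]] <-]].
exact: ABW pi By pj.
Qed.

Lemma bracket_skew_eq0 A B :
  graded_subspace A -> graded_subspace B ->
  prodset A B `<=` [set 0] -> prodset B A `<=` [set 0].
Proof.
move=> gA gB AB0; apply: graded_prodset => //; first exact: subspace_set0.
move=> i j x y Bx pi Ay pj /=; rewrite (hls_skew pi pj).
have -> : br y x = 0 by apply: AB0; exists y => //; exists x.
by rewrite scaler0 oppr0.
Qed.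

(** Two terms of the Hom-Jacobi identity vanish, and the coefficient of the third is a sign, hence
    nonzero. *)
Lemma jacobi_eq0 i j k x y z : part i x -> part j y -> part k z ->
  br y z = 0 -> br z x = 0 -> br (br x y) (phi z) = 0.
Proof.
move=> xi yj zk yz0 zx0; have := hls_jacobi xi yj zk.
rewrite yz0 zx0 !linear0l !scaler0 !addr0 => /eqP.
by rewrite scaler_eq0 signr_eq0 /= => /eqP.
Qed.

Lemma prodset_homogeneous A B : graded_subspace A -> graded_subspace B ->
  prodset A B `<=` lspan (prodset A B `&` homogeneous).
Proof.
move=> gA gB; apply: graded_prodset => //; first exact: lspan_subspace.
move=> i j x y Ax xi By yj; apply: sub_lspan; split.
  by exists x => //; exists y.
by apply/homogeneousP; exists (i (+) j); exact: hls_bracket_part.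
Qed.

Lemma lspan_prodset_graded A B : graded_subspace A -> graded_subspace B ->
  graded_subspace (lspan (prodset A B)).
Proof.
move=> gA gB; apply: lspan_homogeneous_graded => x.
move/(prodset_homogeneous gA gB); apply: lspanS => {}x [xAB xh].
by split=> //; exact: sub_lspan.
Qed.

End Grading.

(** * Root spaces under the twist and the bracket *)

Section RootSpaces.
Context {K : fieldType} {L : homLieSuperalgebra K} (H : gradedSubalgebra L).
Hypothesis regL : is_regular L.

Local Notation br := hls_bracket.
Local Notation phi := hls_twist.
Local Notation part := hls_part.
Local Notation E := (even_part H).
Local Notation tw := (even_twist (H := H)).
Local Notation twV := (even_twistV (H := H)).
Local Notation Lr := (root_space H).
Local Notation Lam := (Defs.roots H).
Implicit Types (x y z v : L) (h : E) (a b d : E -> K).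

Let phi_inj : injective (phi : L -> L).
Proof. by case: regL => /bij_inj. Qed.

Let phi_surj x : exists y, phi y = x.
Proof. by case: regL => -[g _ gK] _; exists (g x). Qed.

Let phi_br x y : phi (br x y) = br (phi x) (phi y).
Proof. by case: regL. Qed.

Lemma even_twist_inj : injective tw.
Proof.
by move=> h h' /(congr1 val) /= /phi_inj /val_inj.
Qed.

Lemma even_twistVK : cancel twV tw.
Proof. by move=> h; rewrite /even_twistV; case: cid. Qed.

Lemma even_twistK : cancel tw twV.
Proof. by move=> h; apply: even_twist_inj; rewrite even_twistVK. Qed.

Lemma even_twist_linear : linear tw.
Proof. by move=> c u v; apply: val_inj; rewrite /= linearP. Qed.

Lemma even_twistV_linear : linear twV.
Proof.
by move=> c u v; apply: even_twist_inj; rewrite even_twist_linear !even_twistVK.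
Qed.

(** The map [alpha |-> alpha phi^-1], which takes the role of [T] in the walks. *)
Definition root_twist a : E -> K := a \o twV.
Local Notation T := root_twist.

Lemma root_twist_zmod_morphism : zmod_morphism root_twist.
Proof. by []. Qed.

HB.instance Definition _ := GRing.isZmodMorphism.Build (E -> K) (E -> K)
  root_twist root_twist_zmod_morphism.

Lemma root_twist_inj : injective T.
Proof.
move=> a b /funeqP ab; apply/funeqP => h.
by have := ab (tw h); rewrite /root_twist /= even_twistK.
Qed.

Lemma root_twist_surj a : exists b, T b = a.
Proof.
by exists (a \o tw); apply/funeqP => h; rewrite /root_twist /= even_twistVK.
Qed.

Lemma scalar_twist a : scalar (T a) <-> scalar a.
Proof.
split=> sa c u v; last by rewrite /root_twist /= even_twistV_linear sa.
have := sa c (tw u) (tw v).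
by rewrite /root_twist /= -even_twist_linear !even_twistK.
Qed.

Lemma even_homogeneous h : part false (val h).
Proof. by case: h => h /= /even_predP[]. Qed.

Lemma even_in h : gs_set H (val h).
Proof. by case: h => h /= /even_predP[]. Qed.

Lemma root_space_subspace a : subspace (Lr a).
Proof.
apply/subspaceP; split=> [h|c u v au av h].
  by rewrite linear0r linear0 scaler0.
by rewrite linearPr au av linearP scalerDr !scalerA mulrC.
Qed.

(** A root space is the common kernel of the maps [[h, -] - a h phi]. These preserve degrees because
    [h] is even, so they kill the even and the odd component of a root vector separately. *)
Lemma root_space_graded a : graded_subspace (Lr a).
Proof.
have sa := root_space_subspace a.
rewrite -[Lr a](smallest_id sa); apply: lspan_homogeneous_graded.
rewrite [lspan (Lr a)](smallest_id sa) => v av.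
have [v0 p0 [v1 p1 vE]] : sumset (part false) (part true) v.
  by have [_ ->] := hls_part_dirsum L.
pose d h w := br (val h) w - a h *: phi w.
have pd i w h : part i w -> part i (d h w).
  have sp := hls_part_subspace L i.
  move=> pw; apply: (subspaceB sp); last first.
    by apply: (subspaceZ _ sp); exact: hls_twist_even.
  exact: (hls_bracket_part (even_homogeneous h)).
have dE h : d h v0 = - d h v1.
  apply/eqP; rewrite -addr_eq0 /d addrACA -opprD -scalerDr.
  by rewrite -linearDr -linearD vE av subrr.
have d0 h : d h v0 = 0.
  apply: part_eq0; first exact: pd.
  by rewrite dE; apply: subspaceN; [exact: hls_part_subspace | exact: pd].
have a0 : Lr a v0 by move=> h; apply/eqP; rewrite -subr_eq0 -/(d h v0) d0.
have a1 : Lr a v1.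
  move=> h; apply/eqP; rewrite -subr_eq0 -/(d h v1).
  by rewrite -[d h v1]opprK -dE d0 oppr0.
rewrite -vE; apply: (subspaceD (lspan_subspace _)).
  by apply: sub_lspan; split=> //; left.
by apply: sub_lspan; split=> //; right.
Qed.

(** As [phi] is an automorphism, [[h, phi v] = phi [phi^-1 h, v]]. *)
Lemma root_space_twist a v : Lr (T a) (phi v) <-> Lr a v.
Proof.
split=> av h.
  apply: phi_inj; rewrite phi_br linearZ.
  by have := av (tw h); rewrite /root_twist /= even_twistK.
rewrite -[h]even_twistVK /= -phi_br av linearZ.
by rewrite /root_twist /= even_twistK.
Qed.

Lemma root_space_twistP a v : Lr (T a) v <-> exists2 w, Lr a w & phi w = v.
Proof.
split=> [|[w aw <-]]; last exact/root_space_twist.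
by have [w <-] := phi_surj v; exists w => //; exact/root_space_twist.
Qed.

(** The Hom-Jacobi identity for [x], [y] and an even [h] gives [[phi h, [x, y]] = (a + b)(h) phi
    [x, y]], and every element of the even part of [H] has the form [phi h]. *)
Lemma root_space_bracket a b :
  prodset (Lr a) (Lr b) `<=` Lr (T (a + b)).
Proof.
apply: graded_prodset; [exact: root_space_graded | exact: root_space_graded
  | exact: root_space_subspace |].
move=> i j x y ax xi by_ yj h0; have [h <-] : exists h, tw h = h0.
  by exists (twV h0); rewrite even_twistVK.
rewrite /root_twist /= even_twistK.
have ph := even_homogeneous h.
have := hls_jacobi xi yj ph; rewrite !andbF !expr0 !scale1r.
rewrite (hls_skew (hls_bracket_part xi yj) (hls_twist_even ph)) andbF.
rewrite expr0 scale1r (hls_skew yj ph) andbF expr0 scale1r ax by_.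
rewrite linearNl !linearZl_LR.
(* The sign produced by exchanging [phi y] and [phi x] cancels the coefficient of the same term in
   the Hom-Jacobi identity. *)
rewrite (hls_skew (hls_twist_even yj) (hls_twist_even xi)).
rewrite (andbC j) !scalerN opprK !scalerA !(mulrC _ (b h)) -mulrA.
rewrite -signr_addb addbb mulr1 -addrA -scalerDl addrC => /eqP.
by rewrite subr_eq0 eq_sym phi_br [_ + a h]addrC => /eqP.
Qed.

Lemma root_of_vector a v : scalar a -> a != 0 -> Lr a v -> v != 0 -> Lam a.
Proof.
move=> sa a0 av /eqP v0; split=> //; apply/eqP => a00; apply: v0.
by move: av; rewrite a00.
Qed.

Lemma roots_twist a : Lam (T a) <-> Lam a.
Proof.
have Ta0 : (T a == 0) = (a == 0).
  by rewrite -[a == 0](inj_eq root_twist_inj) raddf0.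
have L0 : (Lr (T a) = [set 0]) <-> (Lr a = [set 0]).
  split=> a0; apply/seteqP; split=> [v|_ ->].
  - move/(root_space_twist a v).2; rewrite a0 /= => v0.
    by apply: phi_inj; rewrite v0 linear0.
  - exact: (subspace0 (root_space_subspace _)).
  - by move=> /root_space_twistP[w]; rewrite a0 => -> /= <-; rewrite linear0.
  - exact: (subspace0 (root_space_subspace _)).
split=> -[sa a0 n0]; split.
- exact/scalar_twist.
- by rewrite -Ta0.
- by apply: contra_neq n0 => /L0.
- exact/scalar_twist.
- by rewrite Ta0.
- by apply: contra_neq n0 => /L0.
Qed.

End RootSpaces.

(** * Connections as walks, and brackets of linked and unlinked roots *)

Section Classes.
Context {K : fieldType} {L : homLieSuperalgebra K} (H : gradedSubalgebra L).
Hypotheses (regL : is_regular L) (abH : abelian (gs_set H)).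
Hypothesis splitL : is_split H.

Local Notation br := hls_bracket.
Local Notation phi := hls_twist.
Local Notation E := (even_part H).
Local Notation Lr := (root_space H).
Local Notation Lam := (Defs.roots H).
Local Notation T := (@root_twist K L H).
Local Notation pm := (@pm_roots K L H).
Local Notation link := (linked (pm) T).
Implicit Types (x y z v : L) (h : E) (a b d : E -> K) (C D : set (E -> K)).

Lemma pm_roots_opp a : pm a -> pm (- a).
Proof. by case=> [a_|[b b_ <-]]; [right; exists a | left; rewrite opprK]. Qed.

Lemma pm_roots_twist a : pm a -> pm (T a).
Proof.
case=> [a_|[b b_ <-]]; first by left; apply/roots_twist.
by right; exists (T b); [exact/roots_twist | rewrite raddfN].
Qed.

Lemma twisted_neg a n : twisted a (- n%:Z) = iter n T a.
Proof.
have iterT m h : iter m T a h = a (iter m (even_twistV (H := H)) h).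
  by elim: m h => //= m IH h; rewrite /root_twist /= IH -iterSr.
(* Splitting on [n] separates [- 0], a [Posz], from the other values, which are [Negz]. *)
apply/funeqP => h; rewrite iterT; by case: n.
Qed.

(** In [chain_sum c j] the exponent [- j + l - 2] means [j + 2 - l] twists. Raising [j] by one thus
    twists the whole sum once more and adds the term [l = j + 2], twisted once. *)
Lemma chain_sumE (c : nat -> E -> K) i : chain_sum c i = chain T c i.
Proof.
have cE j : chain_sum c j =
    iter j T (c 1%N) + \sum_(2 <= l < j.+2) iter (j.+2 - l) T (c l).
  rewrite /chain_sum twisted_neg; congr (_ + _).
  apply: eq_big_nat => l /andP[_ lj]; rewrite -twisted_neg; congr twisted.
  by lia.
elim: i => [|i IH] /=; first by rewrite cE big_geq // addr0.
rewrite -IH !cE big_nat_recr //= subSnn /= !raddfD raddf_sum addrA.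
congr (_ + _ + _); apply: eq_big_nat => l /andP[_ lj].
by rewrite -iterS -subSn // ltnW.
Qed.

Lemma pm_neg_twistsP b d :
  pm_neg_twists b d <-> exists c m, d = opp_if c (iter m T b).
Proof.
split=> [[[m _ <-]|[_ [m _ <-] <-]]|[[|] [m ->]]].
- by exists false, m; rewrite twisted_neg.
- by exists true, m; rewrite twisted_neg.
- by right; exists (iter m T b) => //; exists m; rewrite ?twisted_neg.
- by left; exists m; rewrite ?twisted_neg.
Qed.

Lemma connectedP a b : Lam a -> Lam b -> connected a b <-> link a b.
Proof.
move=> La Lb; have Pa : pm a by left.
have Pb c m : pm (opp_if c (iter m T b)).
  apply: opp_if_closed; first exact: pm_roots_opp.
  by apply: iter_closed; [exact: pm_roots_twist | left].
split=> [[k [c [k0 Pc k1 k2]]]|[s [m]]].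
  have [n [cn cb]] : exists n, c 1%N = iter n T a /\
      pm_neg_twists b (chain T c k.-1).
    (* For [k = 1] the sum [chain T c 0] is [c 1], so both clauses of the definition yield the same
       two facts. *)
    have [k1'|k1'] := eqVneq k 1%N.
      by have [[n _ nE] bc] := k1 k1'; exists n; rewrite -nE twisted_neg k1'.
    have [[n _ nE] _ bc] := k2 ltac:(lia).
    by exists n; rewrite -nE twisted_neg -chain_sumE.
  have /pm_neg_twistsP[s [m sE]] := cb; exists s, m.
  apply/(reachP pm_roots_twist) => //; exists k.-1, c; split=> //.
  - by exists n.
  - by move=> j jk; apply: Pc; lia.
  (* Clause (ii) stops at [k - 2]; the last partial sum lies in [± Lambda] because it is a signed
     twist of the root [b]. *)
  move=> i ik; have [->|ik'] := eqVneq i k.-1; first by rewrite sE.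
  have [_ + _] := k2 ltac:(lia).
  by move/(_ i); rewrite chain_sumE; apply; lia.
move/(reachP pm_roots_twist _ Pa) => [k [c [[n cn] Pc Pk ck]]].
exists k.+1, c; split=> // [[k0]|k1].
  split; first by exists n => //; rewrite twisted_neg.
  by apply/pm_neg_twistsP; exists s, m; rewrite -ck k0.
split; first by exists n => //; rewrite twisted_neg.
  by move=> i ik; rewrite chain_sumE; apply: Pk; lia.
by apply/pm_neg_twistsP; exists s, m; rewrite /= chain_sumE.
Qed.

Lemma link_sym a b : Lam a -> link a b -> link b a.
Proof.
move=> La; apply: linked_sym; [exact: pm_roots_opp | exact: pm_roots_twist |].
by left.
Qed.

Lemma link_trans b a d : link a b -> link b d -> link a d.
Proof. exact: (linked_trans pm_roots_opp pm_roots_twist). Qed.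

(** From here on classes are handled through [link] alone. *)
Lemma root_classP C : root_classes H C ->
  [/\ C `<=` Lam, forall a b, C a -> C b -> link a b
    & forall a b, C a -> Lam b -> link a b -> C b].
Proof.
move=> [c Lc <-]; split=> [a []//|a b [La ca] [Lb cb]|a b [La ca] Lb ab].
  apply: (@link_trans c); last exact/connectedP.
  by apply: link_sym => //; exact/connectedP.
by split=> //; apply/connectedP => //; apply: link_trans ab; exact/connectedP.
Qed.

Lemma root_class_inj C D a b : root_classes H C -> root_classes H D ->
  C a -> D b -> link a b -> C = D.
Proof.
move=> /root_classP[CL CC CL'] /root_classP[DL DD DL'] Ca Db ab.
have ba : link b a by apply: link_sym => //; exact: CL.
apply/seteqP; split=> d.
  move=> Cd; apply: (DL' b) => //; first exact: CL.
  by apply: link_trans ba _; exact: CC.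
move=> Dd; apply: (CL' a) => //; first exact: DL.
by apply: link_trans ab _; exact: DD.
Qed.

Lemma root_class_mem a : Lam a ->
  root_classes H (root_class a) /\ root_class a a.
Proof.
move=> La; split; first by exists a.
by split=> //; apply/connectedP => //; exact: linked_refl.
Qed.

(** If [b] differs from [- a], then [T (a + b)] is nonzero by injectivity of [T], and a nonzero
    bracket makes it a root. *)
Lemma root_bracket_eq0 a b x y : Lam a -> Lam b -> Lr a x -> Lr b y ->
  [\/ br x y = 0, b = - a | Lam (T (a + b))].
Proof.
move=> [sa _ _] [sb _ _] ax by_.
have [->|xy0] := pselect (br x y = 0); first by constructor 1.
have [->|ba] := eqVneq b (- a); first by constructor 2.
constructor 3; apply: (root_of_vector (v := br x y)).
- apply/scalar_twist => // c u v; rewrite !fctE sa sb mulrDr.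
  by rewrite addrACA.
- rewrite -(raddf0 T) (inj_eq (root_twist_inj regL)) addrC addr_eq0.
  exact: ba.
- by apply: root_space_bracket => //; exists x => //; exists y.
- exact/eqP.
Qed.

(** Opposite roots are linked by a sign. Otherwise [T (a + b)] is a root, one step away from [a] as
    well as from [b]. *)
Lemma bracket_link a b x y : Lam a -> Lam b -> Lr a x -> Lr b y ->
  br x y <> 0 -> link a b.
Proof.
move=> La Lb ax by_ xy0.
have [//|->|Lab] := root_bracket_eq0 La Lb ax by_; first exact: linkedN.
apply: (@link_trans (T (a + b))).
  by apply: linked_step; left.
apply: link_sym => //; rewrite addrC; apply: linked_step; left => //.
by rewrite addrC.
Qed.

Lemma bracket_bracket_eq0 a d x y z : Lam a -> Lam d -> ~ link a d ->
  Lr a x -> Lr (- a) y -> Lr d z -> br (br x y) z = 0.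
Proof.
move=> La Ld nad ax ay dz.
(* The Hom-Jacobi identity wants its outer argument in the form [phi w], so [z] is pulled back to a
   vector [w] of the root [d'], which is still linked to [d]. *)
have [d' d'E] := root_twist_surj d.
have Ld' : Lam d' by apply/roots_twist => //; rewrite d'E.
have d'd : link d' d by rewrite -d'E; exact: linked_twist.
have /(root_space_twistP regL)[w d'w <-] : Lr (T d') z by rewrite d'E.
have xz0 x' z' : Lr a x' -> Lr d' z' -> br z' x' = 0.
  move=> ax' d'z'; apply: contrapT => xz; apply: nad.
  by apply: link_trans d'd; apply: link_sym => //; exact: bracket_link xz.
have yz0 y' z' : Lr (- a) y' -> Lr d' z' -> br y' z' = 0.
  move=> ay' d'z'; apply: contrapT => yz; apply: nad.
  (* That [- a] is a root comes from the vector [y'], which is nonzero since its bracket is. *)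
  have LNa : Lam (- a).
    apply: (root_of_vector (v := y')) => //.
    - by have [sa _ _] := La => c u v; rewrite !fctE sa opprD mulrN.
    - by have [_ a0 _] := La; rewrite oppr_eq0.
    - by apply: contra_not_neq yz => ->; rewrite linear0l.
  apply: link_trans d'd; apply: (@link_trans (- a)); first exact: linkedN.
  exact: bracket_link yz.
have gr := root_space_graded (H := H).
(* To use the Hom-Jacobi identity, [[x, y]] and [phi w] are expanded over homogeneous vectors of the
   same root spaces. *)
pose X := prodset (Lr a `&` homogeneous) (Lr (- a) `&` homogeneous).
have Xxy : lspan X (br x y).
  apply: (prodset_lspan (lspan_subspace X) (@sub_lspan _ _ X)).
  exists x; first by rewrite -graded_homogeneous.
  by exists y; rewrite -?graded_homogeneous.
have Xw : lspan (phi @` (Lr d' `&` homogeneous)) (phi w).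
  move: w d'w {dz}; rewrite {1}(graded_homogeneous (gr d')).
  apply: lspan_sub => [|w dw]; last by apply: sub_lspan; exists w.
  apply: subspace_preimage; exact: lspan_subspace.
apply: (prodset_lspan (@subspace_set0 _ _)); last first.
  by exists (br x y); [exact: Xxy | exists (phi w); [exact: Xw|]].
move=> _ [_ [x' [ax' /homogeneousP[i xi]] [y' [ay' /homogeneousP[j yj]] <-]]
  [_ [z' [dz' /homogeneousP[k zk]] <-] <-]] /=.
by apply: (jacobi_eq0 xi yj zk); [exact: yz0 | exact: xz0].
Qed.


(** * The zero root space and the spaces [H_[alpha]] *)

Lemma gs_set_subspace : subspace (gs_set H).
Proof. by have [[]] := gs_graded H. Qed.

(** The root part [w] of a vector of [L_0] is again in [L_0]. For a root [a], bracketing [w] with an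
    [h] such that [a h] is nonzero shows that the component of [w] at [a] lies in the sum of the
    other root spaces; by independence [w = 0]. *)
Lemma root_space0 : Lr 0 = gs_set H.
Proof.
have sH := gs_set_subspace.
have s0 := root_space_subspace (H := H).
have H0 : gs_set H `<=` Lr 0.
  move=> x Hx h; rewrite scale0r; apply: abH.
  by exists (val h); [exact: even_in | exists x].
apply/seteqP; split=> // v v0.
have [[HS_0 HS] ind] := splitL.
have [u Hu [w Sw uwv]] : sumset (gs_set H) (sumspace Lam Lr) v by rewrite HS.
suff w0 : w = 0 by rewrite -uwv w0 addr0.
have w0 : Lr 0 w.
  have -> : w = v - u by rewrite -uwv addrC addKr.
  by apply: (subspaceB (s0 _)) => //; exact: H0.
apply: (independent_eq0 s0 ind Sw) => a La; have [_ a0 _] := La.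
have sS := sumspace_subspace (Lam `\ a) Lr.
have [y ay [z Sz yzw]] : sumset (Lr a) (sumspace (Lam `\ a) Lr) w.
  move: w Sw {uwv w0}; apply: sumspace_sub; first exact: sumset_subspace.
  move=> b Lb; have [->|ba] := eqVneq b a; first exact: sumset_subl.
  move=> x bx; apply: sumset_subr => //.
  by apply: (sub_sumspace _ bx); split=> //; exact/eqP.
have [h ah] : exists h, a h != 0.
  apply: contrapT => nh; case/eqP: a0; apply/funeqP => h; apply/eqP.
  by apply: contrapT => /negP ah; apply: nh; exists h.
(* On [L_b] the bracket with [h] is [b h] times [phi], so [[h, z]] is [phi] of a vector of the same
   sum, and [phi] can then be cancelled. *)
have [z' Sz' z'E] :
    exists2 z', sumspace (Lam `\ a) Lr z' & phi z' = br (val h) z.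
  move: z Sz {yzw}; apply: sumspace_sub => [|b Lb x bx].
    apply/subspaceP; split=> [|c x1 x2 [y1 Sy1 E1] [y2 Sy2 E2]].
      by exists 0; [exact: subspace0 | rewrite linear0 linear0r].
    exists (c *: y1 + y2); last by rewrite linearPr -E1 -E2 linearP.
    by apply: (subspaceD sS) => //; exact: (subspaceZ _ sS).
  exists (b h *: x); last by rewrite linearZ bx.
  by apply: (subspaceZ _ sS); exact: (sub_sumspace Lb).
have yE : a h *: y = - z'.
  case: regL => /bij_inj phi_inj _; apply: phi_inj.
  rewrite linearZ_LR linearN z'E -ay; apply/eqP.
  by rewrite -addr_eq0 -linearDr yzw w0 scale0r.
rewrite -yzw; apply: (subspaceD sS) => //.
have -> : y = - (a h)^-1 *: z'.
  by rewrite scaleNr -scalerN -yE scalerA mulVf // scale1r.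
exact: (subspaceZ _ sS).
Qed.

Definition opposite_span C : set L :=
  lspan (\bigcup_(a in C) prodset (Lr a) (Lr (- a))).

Lemma opposite_span_subset C : opposite_span C `<=` gs_set H.
Proof.
apply: lspan_sub; first exact: gs_set_subspace.
move=> x [a _] /(root_space_bracket regL).
by rewrite subrr raddf0 root_space0.
Qed.

Lemma gs_set_sumspace_eq0 x : gs_set H x -> sumspace Lam Lr x -> x = 0.
Proof.
move=> Hx Sx; have [[H0 _] _] := splitL.
by have : (gs_set H `&` sumspace Lam Lr) x by []; rewrite H0.
Qed.

(** A product of two root spaces of the class that is neither zero nor opposite lies in a root
    space. Such terms add up to the root part of [x], which vanishes when [x] is in [H]. *)
Lemma class_H_opposite_span C :
  root_classes H C -> class_H H C = opposite_span C.
Proof.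
move=> cC; have [CL CC CC'] := root_classP cC.
apply/seteqP; split=> [x [Cx x0]|x Cx].
  have [y Cy [z Sz yzx]] : sumset (opposite_span C) (sumspace Lam Lr) x.
    move: x Cx {x0}; apply: lspan_sub.
      by apply: sumset_subspace; exact: lspan_subspace.
    move=> _ [a Ca [b Cb [x ax [y by_ <-]]]].
    have [->|ba|Lab] := root_bracket_eq0 (CL a Ca) (CL b Cb) ax by_.
    - apply: subspace0; apply: sumset_subspace; exact: lspan_subspace.
    - apply: sumset_subl; first exact: lspan_subspace.
      apply: sub_lspan; exists a => //; rewrite -ba.
      by exists x => //; exists y.
    - apply: sumset_subr; first exact: lspan_subspace.
      apply: (sub_sumspace Lab); apply: root_space_bracket => //.
      by exists x => //; exists y.
  suff z0 : z = 0 by rewrite -yzx z0 addr0.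
  apply: gs_set_sumspace_eq0 => //.
  have -> : z = x - y by rewrite -yzx addrC addKr.
  apply: (subspaceB gs_set_subspace); last exact: opposite_span_subset Cy.
  by rewrite -root_space0.
split; last by rewrite root_space0; exact: opposite_span_subset Cx.
move: x Cx; apply: lspan_sub; first exact: lspan_subspace.
move=> _ [a Ca [x ax [y ay <-]]].
(* A nonzero [y] makes [- a] a root; being linked to [a], it belongs to [C]. *)
have [->|/eqP y0] := pselect (y = 0).
  by rewrite linear0r; exact: (subspace0 (lspan_subspace _)).
have [sa a0 _] := CL a Ca; have Na := linkedN pm T a.
apply: sub_lspan; exists a => //.
exists (- a); last by exists x => //; exists y.
apply: (CC' a) => //; apply: root_of_vector ay y0; last by rewrite oppr_eq0.
by move=> c u v; rewrite !fctE sa opprD mulrN.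
Qed.

(** * The ideals attached to the classes *)

Definition class_generators C : set L :=
  \bigcup_(a in C) (prodset (Lr a) (Lr (- a)) `|` Lr a).

Lemma sub_class_generators C a : C a -> Lr a `<=` lspan (class_generators C).
Proof. by move=> Ca x ax; apply: sub_lspan; exists a => //; right. Qed.

(** In this form statements on brackets reduce to generators through [prodset_lspan]. *)
Lemma class_L_span C :
  root_classes H C -> class_L H C = lspan (class_generators C).
Proof.
move=> cC; rewrite /class_L class_H_opposite_span //; have sp := lspan_subspace.
apply/seteqP; split.
  apply: sumset_sub => //; apply: lspan_sub => // x [a Ca ax].
    by apply: sub_lspan; exists a => //; left.
  exact: sub_class_generators ax.
have sS := sumset_subspace (sp _ _ _ : subspace (opposite_span C))
  (sp _ _ _ : subspace (class_V H C)).
apply: lspan_sub => // x [a Ca [ax|ax]].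
  by apply: (sumset_subl (sp _ _ _)); apply: sub_lspan; exists a.
by apply: (sumset_subr (sp _ _ _)); apply: sub_lspan; exists a.
Qed.

Lemma class_generators_graded C : graded_subspace (lspan (class_generators C)).
Proof.
apply: lspan_homogeneous_graded => x [a Ca].
have gr := root_space_graded (H := H).
have CE := @sub_lspan _ _ (class_generators C).
case=> [/(prodset_homogeneous (gr a) (gr (- a)))|].
  apply: lspanS => {}x [ax xh]; split=> //.
  by apply: CE; exists a => //; left.
rewrite {1}(graded_homogeneous (gr a)).
apply: lspanS => {}x [ax xh]; split=> //.
by apply: CE; exists a => //; right.
Qed.

Lemma class_twist C a : root_classes H C -> C (T a) <-> C a.
Proof.
move=> /root_classP[CL _ CC']; split=> [CTa|Ca].
  apply: (CC' (T a)) => //; last exact: twist_linked.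
  exact/(roots_twist regL)/CL.
apply: (CC' a) => //; last exact: linked_twist.
exact/(roots_twist regL)/CL.
Qed.

(** [phi] maps [L_a] onto [L_(T a)], and [T] permutes the class. *)
Lemma class_generators_twist C : root_classes H C ->
  phi @` lspan (class_generators C) = lspan (class_generators C).
Proof.
move=> cC; have sC := lspan_subspace (class_generators C).
have [_ phi_br] := regL.
apply/seteqP; split.
  suff: lspan (class_generators C) `<=` phi @^-1` lspan (class_generators C).
    by move=> sub _ [x Cx <-]; exact: sub.
  apply: lspan_sub; first exact: subspace_preimage.
  move=> x [a Ca ax]; apply: sub_lspan; exists (T a); first exact/class_twist.
  case: ax => [[y ay [z az <-]]|ax]; last by right; exact/root_space_twist.
  left; rewrite phi_br -raddfN; exists (phi y); first exact/root_space_twist.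
  by exists (phi z) => //; exact/root_space_twist.
apply: lspan_sub; first exact: subspace_image.
move=> x [a Ca]; have [b bE] := root_twist_surj a.
have Cb : C b by apply/(class_twist b cC); rewrite bE.
have bg := @sub_lspan _ _ (class_generators C).
rewrite -bE -raddfN; case=> [[y /(root_space_twistP regL)[y' by' <-]]|].
  move=> [z /(root_space_twistP regL)[z' bz' <-] <-].
  exists (br y' z'); last by rewrite phi_br.
  by apply: bg; exists b => //; left; exists y' => //; exists z'.
move=> /(root_space_twistP regL)[y by_ <-]; exists y => //.
by apply: bg; exists b => //; right.
Qed.

Lemma split_setT : [set: L] = lspan (gs_set H `|` \bigcup_(a in Lam) Lr a).
Proof.
have [[_ <-] _] := splitL; have sp := lspan_subspace.
apply/seteqP; split.
  apply: sumset_sub => //; first by move=> x Hx; apply: sub_lspan; left.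
  by apply: lspanS => x Sx; right.
have sS := sumset_subspace gs_set_subspace (sumspace_subspace Lam Lr).
apply: lspan_sub => // x [Hx|Sx]; first exact: (sumset_subl (sp _ _ _)).
by apply: (sumset_subr gs_set_subspace); exact: sub_lspan.
Qed.

Lemma class_generators_ideal C : root_classes H C ->
  prodset (lspan (class_generators C)) setT `<=` lspan (class_generators C).
Proof.
move=> cC; have [CL CC CC'] := root_classP cC; rewrite split_setT.
have sC := lspan_subspace (class_generators C).
have CH a : C a -> prodset (Lr a) (gs_set H) `<=` lspan (class_generators C).
  move=> Ca x; rewrite -root_space0 => /(root_space_bracket regL).
  by rewrite addr0; apply: sub_class_generators; exact/class_twist.
apply: prodset_lspan => // _ [x [a Ca ax] [z zE <-]].
have La := CL a Ca.
case: ax => [ax|ax]; last first.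
  case: zE => [Hz|[d Ld dz]].
    by apply: CH Ca _ _; exists x => //; exists z.
  have [->|/(bracket_link La Ld ax dz) ad] := pselect (br x z = 0).
    exact: subspace0.
  have Cd : C d by exact: CC' ad.
  have [->|da|Lad] := root_bracket_eq0 La Ld ax dz; first exact: subspace0.
    apply: sub_lspan; exists a => //; left.
    by exists x => //; exists z; rewrite -?da.
  have Cad : C (T (a + d)) by apply: (CC' a) => //; apply: linked_step; left.
  apply: (sub_class_generators Cad); apply: root_space_bracket => //.
  by exists x => //; exists z.
have Hx : gs_set H x.
  by apply: (@opposite_span_subset C); apply: sub_lspan; exists a.
case: zE => [Hz|[d Ld dz]].
  have -> : br x z = 0 by apply: abH; exists x => //; exists z.
  exact: subspace0.
(* As [x] lies in [H = L_0], it sends [L_d] into [L_(T d)], which settles [d] in the class; for [d]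
   outside it the bracket vanishes by the Hom-Jacobi identity. *)
have [Cd|nCd] := pselect (C d).
  have CTd : C (T d) by exact/class_twist.
  apply: (sub_class_generators CTd); rewrite -[d]add0r.
  apply: root_space_bracket => //; exists x; first by rewrite root_space0.
  by exists z.
case: ax => [x1 ax1 [x2 ax2 <-]].
rewrite (bracket_bracket_eq0 La Ld _ ax1 ax2 dz).
  exact: subspace0.
by move=> ad; apply: nCd; exact: CC' ad.
Qed.

Lemma class_generators_orthogonal C D :
  root_classes H C -> root_classes H D -> C <> D ->
  prodset (lspan (class_generators C)) (lspan (class_generators D))
    `<=` [set 0].
Proof.
move=> cC cD nCD; apply: prodset_lspan; first exact: subspace_set0.
have [[CL _ _] [DL _ _]] := (root_classP cC, root_classP cD).
have nlink a b : C a -> D b -> ~ link a b.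
  by move=> Ca Db ab; apply: nCD; exact: root_class_inj ab.
have oppH a x : prodset (Lr a) (Lr (- a)) x -> gs_set H x.
  move=> ax; apply: (@opposite_span_subset setT); apply: sub_lspan.
  by exists a.
have oppL a b : Lam a -> Lam b -> ~ link a b ->
    prodset (lspan (prodset (Lr a) (Lr (- a)))) (Lr b) `<=` [set 0].
  move=> La Lb nab.
  rewrite -[Lr b](smallest_id (root_space_subspace b)).
  apply: prodset_lspan; first exact: subspace_set0.
  move=> _ [_ [x ax [y ay <-]] [z bz <-]].
  exact: bracket_bracket_eq0 nab ax ay bz.
move=> _ [x [a Ca ax] [y [b Db by_] <-]] /=.
have [[La Lb] nab] := (CL a Ca, DL b Db, nlink a b Ca Db).
have nba : ~ link b a by move=> ba; apply: nab; exact: link_sym.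
case: ax by_ => [ax|ax] [by_|by_].
- by apply: abH; exists x; [exact: oppH ax | exists y; [exact: oppH by_|]].
- by apply: (oppL a b) => //; exists x; [exact: sub_lspan | exists y].
(* This case mirrors the previous one. Exchanging the factors requires graded subspaces, hence the
   span of the product set. *)
- apply: (bracket_skew_eq0 _ (root_space_graded a) (oppL b a Lb La nba)).
    by apply: lspan_prodset_graded; exact: root_space_graded.
  by exists x => //; exists y => //; exact: sub_lspan.
- by apply: contrapT => xy; apply: nab; exact: bracket_link xy.
Qed.


End Classes.

(** * The decomposition into a complement and ideals *)

Theorem theorem3p2 (K : fieldType) (L : homLieSuperalgebra K)
    (H : gradedSubalgebra L) (regL : is_regular L)
    (maxH : maximal_abelian (gs_set H)) (splitL : is_split H) :
  [/\ (exists U : set L, linear_complement (gs_set H) (opposite_products H) U),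
      (forall U : set L,
         linear_complement (gs_set H) (opposite_products H) U ->
         sumset U (sumspace (root_classes H) (class_L H)) = setT),
      (forall C, root_classes H C ->
         [/\ is_dirsum (class_H H C) (class_V H C) (class_L H C),
             independent C (root_space H)
           & is_ideal (class_L H C)])
    & (forall C D, root_classes H C -> root_classes H D -> C <> D ->
         prodset (class_L H C) (class_L H D) `<=` [set 0])].
Proof.
have [_ abH _] := maxH; have sH := gs_set_subspace H.
have oppE : opposite_products H = opposite_span (Defs.roots H) by [].
split.
- apply: linear_complement_exists => //; first exact: lspan_subspace.
  by rewrite oppE; exact: opposite_span_subset.
- move=> U [sU [_ UH]]; apply/seteqP; split=> // x _.
  have sI := sumspace_subspace (root_classes H) (class_L H).
  have sS := sumset_subspace sU sI.
  have gI a : Defs.roots H a ->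
      prodset (root_space H a) (root_space H (- a)) `|` root_space H a
      `<=` sumspace (root_classes H) (class_L H).
    move=> La y ay; have [cC Ca] := root_class_mem regL La.
    apply: (sub_sumspace cC); rewrite class_L_span //.
    by apply: sub_lspan; exists a.
  have : lspan (gs_set H `|` \bigcup_(a in Defs.roots H) root_space H a) x.
    by rewrite -split_setT.
  move: x; apply: lspan_sub => // x [|[a La ax]]; last first.
    by apply: sumset_subr => //; apply: (gI a) => //; right.
  (* An element of [H] splits along [U] and the opposite products, and each product lies in the
     ideal of the class of its root. *)
  rewrite -UH; move: x; apply: sumset_sub => //; first exact: sumset_subl.
  apply: lspan_sub => // x [a La ax].
  by apply: sumset_subr => //; apply: (gI a) => //; left.
- move=> C cC; have [CL _ _] := root_classP regL cC.
  have s0 := root_space_subspace (H := H).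
  split; last 2 first.
  + by case: splitL => _; exact: independentS.
  + rewrite class_L_span //.
    have idC := class_generators_ideal regL abH splitL cC.
    split=> //; split; [exact: class_generators_graded | | ].
      by move=> _ [x Cx [y Cy <-]]; apply: idC; exists x => //; exists y.
    exact: class_generators_twist.
  (* [H_[alpha]] lies in [H] and [V_[alpha]] in the sum of all root spaces, which meet in 0 by the
     splitting. *)
  split=> //; apply/seteqP; split=> [x [xH xV]|_ ->].
    apply: (gs_set_sumspace_eq0 splitL); last exact: sumspaceS xV.
    move: xH; rewrite class_H_opposite_span //.
    by move=> /opposite_span_subset; apply.
  split; last exact: (subspace0 (sumspace_subspace _ _)).
  by rewrite class_H_opposite_span //; exact: (subspace0 (lspan_subspace _)).
- move=> C D cC cD nCD; rewrite !class_L_span //.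
  exact: class_generators_orthogonal.
Qed.
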